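(* Let $P\subseteq\mathbb{R}^n$ be an $n$-dimensional lattice polytope which is not unimodularly equivalent to $\Delta_n$. Define \[d(P):=\begin{cases} 2\,(n-\lfloor \mu(P)\rfloor) & \text{if } \mu(P)\notin\mathbb{N},\\ 2\,(n-\mu(P))+1 & \text{if } \mu(P)\in\mathbb{N}.\end{cases}\] If $n>d(P)$, then $P$ is unimodularly equivalent to a Cayley sum $P_0*\cdots*P_t$ of lattice polytopes $P_0,\dots,P_t\subseteq\mathbb{R}^m$ with $m\le d(P)$.
   Context: Write $P$ irredundantly as $P=\{x\in\mathbb{R}^n:\langle a_i,x\rangle\ge b_i,\ i=1,\dots,m'\}$ with primitive $a_i\in(\mathbb{Z}^n)^*$, $b_i\in\mathbb{Q}$, each inequality defining a facet of $P$. Put $d_P(x):=\min_i(\langle a_i,x\rangle-b_i)$ and, for $s\ge 0$, $P^{(s)}:=\{x\in\mathbb{R}^n: d_P(x)\ge s\}$. The $\mathbb{Q}$-codegree is $\mu(P):=(\sup\{s>0: P^{(s)}\neq\emptyset\})^{-1}$. $\Delta_n=\mathrm{conv}(0,e_1,\dots,e_n)$ is the unimodular simplex. Two lattice polytopes are unimodularly equivalent if an affine lattice automorphism of $\mathbb{Z}^n$ maps one onto the other. For lattice polytopes $P_0,\dots,P_t\subseteq\mathbb{R}^k$, the Cayley sum $P_0*\cdots*P_t$ is the convex hull of $(P_0\times 0)\cup(P_1\times e_1)\cup\cdots\cup(P_t\times e_t)$ in $\mathbb{R}^k\times\mathbb{R}^t$, where $e_1,\dots,e_t$ is the standard basis of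 $\mathbb{R}^t$; ''$P$ is unimodularly equivalent to $P_0*\cdots*P_t$'' means there is an affine lattice basis identifying $\mathbb{Z}^n\cong\mathbb{Z}^k\times\mathbb{Z}^t$ under which $P$ becomes this Cayley sum. *)

(* Defs.v *)
From HB Require Import structures.
From mathcomp Require Import all_boot all_order all_algebra.
From mathcomp Require Import boolp classical_sets reals.
Set Implicit Arguments. Unset Strict Implicit. Unset Printing Implicit Defensive.
Import Order.TTheory GRing.Theory Num.Theory.
Local Open Scope ring_scope.
Local Open Scope classical_set_scope.

Section Defs.
Variable R : realType.

Definition int_vec n (x : 'rV[R]_n) : Prop := forall i, x 0 i \is a Num.int.
Definition int_mx m n (A : 'M[R]_(m, n)) : Prop := forall i j, A i j \is a Num.int.

Definition conv n (S : set 'rV[R]_n) : set 'rV[R]_n :=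
  [set x | exists (k : nat) (p : 'I_k -> 'rV[R]_n) (w : 'I_k -> R),
     (forall i, S (p i)) /\ (forall i, 0 <= w i) /\ \sum_(i < k) w i = 1 /\
     x = \sum_(i < k) w i *: p i].

Definition lattice_polytope n (P : set 'rV[R]_n) : Prop :=
  exists V : seq 'rV[R]_n, V != [::] /\ (forall v, v \in V -> int_vec v) /\
    P = conv [set v | v \in V].

Definition affdim_ge n (S : set 'rV[R]_n) (k : nat) : Prop :=
  exists p : 'I_k.+1 -> 'rV[R]_n, (forall i, S (p i)) /\
    \rank (\matrix_(i < k, j < n) (p (lift ord0 i) 0 j - p ord0 0 j)) = k.

Definition full_dim n (P : set 'rV[R]_n) : Prop := affdim_ge P n.

Definition dot n (a x : 'rV[R]_n) : R := \sum_(i < n) a 0 i * x 0 i.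

Definition primitive n (a : 'rV[R]_n) : Prop :=
  int_vec a /\
  forall k : int, (1 < k)%R -> ~ exists c, int_vec c /\ a = k%:~R *: c.

Definition facet_ineq n (P : set 'rV[R]_n) (a : 'rV[R]_n) (b : R) : Prop :=
  primitive a /\ (forall x, P x -> b <= dot a x) /\
  affdim_ge (P `&` [set x | dot a x = b]) n.-1.

Definition Ps n (P : set 'rV[R]_n) (s : R) : set 'rV[R]_n :=
  [set x | forall a b, facet_ineq P a b -> s <= dot a x - b].

Definition codegree n (P : set 'rV[R]_n) : R :=
  (sup [set s : R | 0 < s /\ Ps P s !=set0])^-1.

Definition dP n (P : set 'rV[R]_n) : R :=
  let mu := codegree P in
  if mu \is a Num.nat then 2 * (n%:R - mu) + 1
  else 2 * (n%:R - (Num.floor mu)%:~R).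

Definition unimod_equiv k n (P : set 'rV[R]_k) (Q : set 'rV[R]_n) : Prop :=
  exists (U : 'M[R]_(k, n)) (Ui : 'M[R]_(n, k)) (w : 'rV[R]_n),
    int_mx U /\ int_mx Ui /\ int_vec w /\
    U *m Ui = 1%:M /\ Ui *m U = 1%:M /\
    Q = [set x *m U + w | x in P].

Definition Delta n : set 'rV[R]_n :=
  conv [set x | x = 0 \/ exists i, x = delta_mx 0 i].

(* e_0 = 0, e_i = i-th standard basis vector of R^t *)
Definition cay_e t (i : 'I_t.+1) : 'rV[R]_t :=
  \row_(j < t) (if j.+1 == val i then 1 else 0).

Definition cayley m t (Pi : 'I_t.+1 -> set 'rV[R]_m) : set 'rV[R]_(m + t) :=
  conv [set x | exists i p, Pi i p /\ x = row_mx p (cay_e i)].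

End Defs.

(* Main.v *)
Require Import Defs.
From mathcomp Require Import all_boot all_order all_algebra.
From mathcomp Require Import boolp classical_sets reals.
From mathcomp Require Import lra.
Set Implicit Arguments. Unset Strict Implicit. Unset Printing Implicit Defensive.
Import Order.TTheory GRing.Theory Num.Theory.
Local Open Scope ring_scope.
Local Open Scope classical_set_scope.

(** Linear programming duality and Carathéodory's theorem write the constant function 1
    as [\sum_i l_i (a_i x - b_i)] with at most [n + 1] linearly independent facet
    functionals, [l_i > 0] and [\sum_i l_i >= mu]. At a vertex each facet functional is a
    natural number, so [l_i <= 1], and at most one of those with [l_i > 1/2] is nonzero,
    with value 1. Hence these functionals, together with the difference between 1 and
    their sum, are nonnegative integral functionals with sum 1, which exhibits [P] as a
    Cayley sum; as [\sum_i l_i >= mu], there are at least [2 mu - n - 1] indices with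
    [l_i > 1/2]. If the difference vanishes, independence forces all [l_i = 1], so there
    are at least [mu] functionals, and [n + 1] of them only if [P] is the simplex. *)

(** * The dot product as a bilinear form *)

Lemma dotE {R : realType} {n} (a x : 'rV[R]_n) : dot a x = (a *m x^T) 0 0.
Proof. by rewrite !mxE; apply: eq_bigr => i _; rewrite !mxE. Qed.

Lemma dotC {R : realType} {n} (a x : 'rV[R]_n) : dot a x = dot x a.
Proof. by apply: eq_bigr => i _; rewrite mulrC. Qed.

Lemma dotDl {R : realType} {n} (a b x : 'rV[R]_n) :
  dot (a + b) x = dot a x + dot b x.
Proof. by rewrite !dotE mulmxDl mxE. Qed.

Lemma dotZl {R : realType} {n} c (a x : 'rV[R]_n) : dot (c *: a) x = c * dot a x.
Proof. by rewrite !dotE -scalemxAl mxE. Qed.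

Lemma dotDr {R : realType} {n} (a x y : 'rV[R]_n) :
  dot a (x + y) = dot a x + dot a y.
Proof. by rewrite dotC dotDl !(dotC _ a). Qed.

Lemma dotZr {R : realType} {n} c (a x : 'rV[R]_n) : dot a (c *: x) = c * dot a x.
Proof. by rewrite dotC dotZl dotC. Qed.

Lemma dotBr {R : realType} {n} (a x y : 'rV[R]_n) :
  dot a (x - y) = dot a x - dot a y.
Proof. by rewrite -scaleN1r dotDr dotZr mulN1r. Qed.

Lemma dot0l {R : realType} {n} (x : 'rV[R]_n) : dot 0 x = 0.
Proof. by rewrite dotE mul0mx mxE. Qed.

Lemma dot_suml {R : realType} {n} {I : finType} (Q : pred I) (F : I -> 'rV[R]_n) x :
  dot (\sum_(i | Q i) F i) x = \sum_(i | Q i) dot (F i) x.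
Proof.
apply: (big_morph (fun a => dot a x)) => [a b|]; [exact: dotDl | exact: dot0l].
Qed.

Lemma dot_sumr {R : realType} {n} {I : finType} (Q : pred I) (F : I -> 'rV[R]_n) a :
  dot a (\sum_(i | Q i) F i) = \sum_(i | Q i) dot a (F i).
Proof. by rewrite dotC dot_suml; apply: eq_bigr => i _; rewrite dotC. Qed.

Lemma dot_row_mx {R : realType} {m n} (a x : 'rV[R]_m) (b y : 'rV[R]_n) :
  dot (row_mx a b) (row_mx x y) = dot a x + dot b y.
Proof. by rewrite !dotE tr_row_mx mul_row_col mxE. Qed.

Lemma dot_scalar {R : realType} (b c : R) : dot b%:M c%:M = b * c :> R.
Proof. by rewrite dotE tr_scalar_mx -scalar_mxM mxE eqxx mulr1n. Qed.

Lemma dot_sqr_gt0 {R : realType} {n} (a : 'rV[R]_n) : a != 0 -> 0 < dot a a.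
Proof.
move=> a0; rewrite lt0r; apply/andP; split; last first.
  by apply: sumr_ge0 => i _; rewrite -expr2 sqr_ge0.
apply: contra a0; rewrite psumr_eq0 => [/allP h|i _]; last by rewrite -expr2 sqr_ge0.
apply/eqP/rowP => i; rewrite mxE; apply/eqP.
by have := h i (mem_index_enum _); rewrite /= -expr2 sqrf_eq0.
Qed.

(** * The theorem of the alternative and Carathéodory's theorem *)

Lemma uniform_eps {R : realType} {k} (Q : 'I_k -> R -> Prop) :
  (forall i, exists2 e, 0 < e & forall d, 0 < d <= e -> Q i d) ->
  exists2 e, 0 < e & forall i, Q i e.
Proof.
elim: k Q => [|k IH] Q hQ; first by exists 1 => // -[].
have [e0 e00 h0] := hQ ord0.
have [e e_gt0 he] : exists2 e, 0 < e & forall i d, 0 < d <= e -> Q (lift ord0 i) d.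
  have := IH (fun i e => forall d, 0 < d <= e -> Q (lift ord0 i) d); apply=> i.
  have [e e_gt0 he] := hQ (lift ord0 i).
  exists e => // d /andP[d0 de] d' /andP[d'0 d'd].
  by apply: he; rewrite d'0 (le_trans d'd).
have m_gt0 : 0 < Num.min e0 e by rewrite lt_min e00.
exists (Num.min e0 e) => // i; case: (unliftP ord0 i) => [j|] ->.
  by apply: he; rewrite m_gt0 ge_min lexx orbT.
by apply: h0; rewrite m_gt0 ge_min lexx.
Qed.

Lemma perturb_gt0 {R : realType} {N k} (f : 'I_k -> 'rV[R]_N) x y :
  (forall i, 0 < dot (f i) x) ->
  exists2 e, 0 < e & forall i, 0 < dot (f i) (x + e *: y).
Proof.
move=> hx; apply: (@uniform_eps _ _ (fun i e => 0 < dot (f i) (x + e *: y))) => i.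
have fx := hx i.
have den : 0 < 2 * (1 + `|dot (f i) y|) by have := normr_ge0 (dot (f i) y); lra.
exists (dot (f i) x / (2 * (1 + `|dot (f i) y|))); first exact: divr_gt0.
move=> d /andP[d0]; rewrite ler_pdivlMr // dotDr dotZr => hd.
have := ler_norm (- (dot (f i) y)); rewrite normrN => hn.
have : d * (- dot (f i) y) <= d * `|dot (f i) y| by rewrite ler_pM2l.
have : 0 <= d * `|dot (f i) y| by rewrite mulr_ge0 // ltW.
by lra.
Qed.

(* Gordan's theorem of the alternative, by induction on the number of functionals:
   a last functional negative at a solution [x] for the others is eliminated by
   making the others vanish at [x]. *)
Lemma gordan {R : realType} {N k} (f : 'I_k -> 'rV[R]_N) :
  ~ (exists x, forall i, 0 < dot (f i) x) ->
  exists l : 'I_k -> R, (forall i, 0 <= l i) /\ (exists i, 0 < l i) /\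
    \sum_i l i *: f i = 0.
Proof.
elim: k f => [|k IH] f nox; first by case: nox; exists 0 => -[].
pose cons (c : R) (l : 'I_k -> R) i := if unlift ord0 i is Some j then l j else c.
have consS c l j : cons c l (lift ord0 j) = l j by rewrite /cons liftK.
have cons0 c l : cons c l ord0 = c by rewrite /cons unlift_none.
have consP c l : 0 <= c -> (forall i, 0 <= l i) -> forall i, 0 <= cons c l i.
  by move=> c0 l0 i; rewrite /cons; case: (unlift _ _).
case: (pselect (exists x, forall i, 0 < dot (f (lift ord0 i)) x)) => [[x hx]|]; last first.
  move=> /IH[l [l0 [[i li] ls]]]; exists (cons 0 l); split; first exact: consP.
  split; first by exists (lift ord0 i); rewrite consS.
  rewrite big_ord_recl cons0 scale0r add0r -[RHS]ls.
  by apply: eq_bigr => j _; rewrite consS.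
have all_pos y : 0 < dot (f ord0) y -> ~ (forall i, 0 < dot (f (lift ord0 i)) y).
  by move=> h0 hS; apply: nox; exists y => i; case: (unliftP ord0 i) => [j|] ->.
case: (ltrgtP (dot (f ord0) x) 0) => [f0x|f0x|f0x].
- pose c i := dot (f (lift ord0 i)) x / - dot (f ord0) x.
  have c0 i : 0 < c i by rewrite divr_gt0 ?oppr_gt0.
  (* [c i > 0] is chosen so that [f' i] vanishes at [x]; a nonnegative dependence among the [f' i]
     unfolds to one among the [f i]. *)
  pose f' i := f (lift ord0 i) + c i *: f ord0.
  have f'x i : dot (f' i) x = 0.
    rewrite dotDl dotZl /c invrN mulrN mulNr mulfVK ?subrr //.
    by rewrite lt_eqF.
  case: (pselect (exists y, forall i, 0 < dot (f' i) y)) => [[y hy]|]; last first.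
    move=> /IH[l [l0 [[i li] ls]]].
    exists (cons (\sum_j l j * c j) l); split.
      by apply: consP => //; apply: sumr_ge0 => j _; rewrite mulr_ge0 // ltW.
    split; first by exists (lift ord0 i); rewrite consS.
    rewrite big_ord_recl cons0 -[RHS]ls scaler_suml -big_split /=.
    by apply: eq_bigr => j _; rewrite consS /f' scalerDr scalerA addrC.
  (* Moving [y] along [x] into the kernel of [f ord0] does not change any [f' i]; a further small
     step along [- x] makes [f ord0] positive. *)
  pose z := y - (dot (f ord0) y / dot (f ord0) x) *: x.
  have f0z : dot (f ord0) z = 0.
    by rewrite dotBr dotZr mulfVK ?subrr // lt_eqF.
  have fz i : 0 < dot (f (lift ord0 i)) z.
    have := hy i; suff -> : dot (f' i) y = dot (f (lift ord0 i)) z by [].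
    have -> : dot (f' i) y = dot (f' i) z.
      by rewrite [RHS]dotBr dotZr f'x mulr0 subr0.
    by rewrite dotDl dotZl f0z mulr0 addr0.
  have [e e0 he] := perturb_gt0 (- x) fz.
  case: (all_pos (z + e *: - x)) => //.
  rewrite dotDr f0z add0r dotZr -scaleN1r dotZr mulN1r.
  by rewrite mulr_gt0 // oppr_gt0.
- by case: (all_pos x).
(* Either [f ord0] is zero, a dependence on its own, or a small step along [f ord0] itself makes it
   positive. *)
- have [f00|f0n] := eqVneq (f ord0) 0.
    exists (cons 1 (fun=> 0)); split; first exact: consP.
    split; first by exists ord0; rewrite cons0.
    rewrite big_ord_recl cons0 f00 scaler0 add0r big1 // => i _.
    by rewrite consS scale0r.
  have [e e0 he] := perturb_gt0 (f ord0) hx.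
  case: (all_pos (x + e *: f ord0)) => //.
  by rewrite dotDr f0x add0r dotZr mulr_gt0 // dot_sqr_gt0.
Qed.

(* A linear dependence can be used in the direction that does not decrease the total
   weight, because positivity on [z] forces it to have a negative coefficient. *)
Lemma caratheodory_sum {R : realType} {N} (X : set 'rV[R]_N) z y mu :
  (forall g, X g -> 0 < dot g z) ->
  (exists r (g : 'I_r -> 'rV[R]_N) (l : 'I_r -> R), (forall i, X (g i)) /\
     (forall i, 0 <= l i) /\ \sum_i l i *: g i = y /\ mu <= \sum_i l i) ->
  exists r (g : 'I_r -> 'rV[R]_N) (l : 'I_r -> R), (forall i, X (g i)) /\
     (forall i, 0 < l i) /\ \sum_i l i *: g i = y /\ mu <= \sum_i l i /\
     (forall k : 'I_r -> R, \sum_i k i *: g i = 0 -> forall i, k i = 0).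
Proof.
move=> Xz ex.
pose good r := exists (g : 'I_r -> 'rV[R]_N) (l : 'I_r -> R), (forall i, X (g i)) /\
     (forall i, 0 <= l i) /\ \sum_i l i *: g i = y /\ mu <= \sum_i l i.
have ex' : exists r, `[< good r >] by case: ex => r h; exists r; apply/asboolP.
case: (ex_minnP ex') => r /asboolP[g [l [Xg [l0 [lg lmu]]]]] rmin.
(* By minimality of [r], admissible weights are strictly positive: an index of weight zero could be
   dropped. *)
have lgt0 l' : (forall i, 0 <= l' i) -> \sum_i l' i *: g i = y ->
    mu <= \sum_i l' i -> forall i, 0 < l' i.
  move=> l'0 l'g l'mu i; rewrite lt0r l'0 andbT; apply/negP => /eqP l'i0.
  have rgt0 : (0 < r)%N by exact: leq_ltn_trans (ltn_ord i).
  suff /rmin : `[< good r.-1 >] by rewrite leqNgt ltn_predL rgt0.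
  apply/asboolP; exists (g \o lift i), (l' \o lift i).
  split; [by move=> j /=|split; first by move=> j /=].
  by move: l'g l'mu; rewrite !(bigD1_ord (P := xpredT) i) //= l'i0 scale0r !add0r.
exists r, g, l; do !split => //; first exact: lgt0.
suff ind : forall k : 'I_r -> R, \sum_i k i *: g i = 0 -> 0 <= \sum_i k i ->
    forall i, k i = 0.
  move=> k kg; case: (leP 0 (\sum_i k i)) => [|/ltW k0]; first exact: ind.
  move=> i; apply: oppr_inj; rewrite oppr0; apply: (ind (fun i => - k i)).
    by under eq_bigr do rewrite scaleNr; rewrite sumrN kg oppr0.
  by rewrite sumrN oppr_ge0.
move=> k kg ks.
case: (pselect (exists i, k i < 0)) => [[i0 ki0]|nok].
  have [i ki imin] : exists2 i, k i < 0 & forall j, k j < 0 -> l i / - k i <= l j / - k j.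
    case: (@arg_minP _ _ _ i0 (fun i => k i < 0) (fun i => l i / - k i)) => // i ki h.
    by exists i.
  pose t := l i / - k i.
  have t0 : 0 <= t by rewrite divr_ge0 // oppr_ge0 ltW.
  have /(_ i) : forall j, 0 < l j + t * k j.
    apply: lgt0 => [j||].
    - case: (ltP (k j) 0) => kj; last by rewrite addr_ge0 // mulr_ge0.
      have := imin j kj; rewrite -/t ler_pdivlMr ?oppr_gt0 //.
      by rewrite mulrN; lra.
    - under eq_bigr do rewrite scalerDl -scalerA.
      by rewrite big_split /= -scaler_sumr kg scaler0 addr0.
    - by rewrite big_split /= -mulr_sumr (le_trans lmu) // lerDl mulr_ge0.
  by rewrite /t invrN mulrN mulNr mulfVK ?subrr ?ltxx // lt_eqF.
have k0 i : 0 <= k i by rewrite leNgt; apply/negP => ki; apply: nok; exists i.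
have : \sum_i k i * dot (g i) z = 0.
  have := dot_suml xpredT (fun i => k i *: g i) z; rewrite kg dot0l => h.
  by rewrite [RHS]h; apply: eq_bigr => i _; rewrite dotZl.
move/eqP; rewrite psumr_eq0 => [/allP h i|i _]; last by rewrite mulr_ge0 // ltW // Xz.
have := h i (mem_index_enum _); rewrite /= mulf_eq0 => /orP[/eqP //|/eqP gz].
by have := Xz _ (Xg i); rewrite gz ltxx.
Qed.

Lemma independent_leq {R : realType} {N r} (g : 'I_r -> 'rV[R]_N) :
  (forall k : 'I_r -> R, \sum_i k i *: g i = 0 -> forall i, k i = 0) -> (r <= N)%N.
Proof.
move=> ind; pose A := \matrix_i g i.
have /eqP <- : row_free A.
  apply: inj_row_free => v vA; apply/rowP => i; rewrite mxE.
  apply: (ind (fun i => v 0 i)); rewrite -[RHS]vA mulmx_sum_row.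
  by apply: eq_bigr => j _; rewrite rowK.
exact: rank_leq_col.
Qed.

(** * Convex hulls of finite sets *)

Lemma conv_incl {R : realType} {n} (S : set 'rV[R]_n) x : S x -> conv S x.
Proof.
move=> Sx; exists 1%N, (fun=> x), (fun=> 1).
by rewrite !big_ord1 scale1r; do !split => // i; exact: ler01.
Qed.

Lemma conv_seqP {R : realType} {n} (V : seq 'rV[R]_n) x :
  conv [set v | v \in V] x <->
  exists w : 'I_(size V) -> R, (forall i, 0 <= w i) /\ \sum_i w i = 1 /\
    x = \sum_i w i *: V`_i.
Proof.
split=> [[k [p [w [pV [w0 [w1 ->]]]]]]|[w [w0 [w1 ->]]]]; last first.
  exists (size V), (fun i => V`_i), w; do !split => // i.
  exact: mem_nth.
have pP i : (index (p i) V < size V)%N by rewrite index_mem; exact: pV.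
pose f i := Ordinal (pP i).
exists (fun l => \sum_(i | f i == l) w i); split; first by move=> l; exact: sumr_ge0.
split; first by rewrite -[RHS]w1 [RHS](partition_big f xpredT).
rewrite (partition_big f xpredT) //=; apply: eq_bigr => l _.
rewrite scaler_suml; apply: eq_bigr => i /eqP <-.
by rewrite /= nth_index //; exact: pV.
Qed.

Lemma conv_seq_convex {R : realType} {n} (V : seq 'rV[R]_n) k (p : 'I_k -> 'rV[R]_n)
    (w : 'I_k -> R) :
  (forall i, conv [set v | v \in V] (p i)) -> (forall i, 0 <= w i) ->
  \sum_i w i = 1 -> conv [set v | v \in V] (\sum_i w i *: p i).
Proof.
move=> pV w0 w1.
have /choice[u hu] : forall i, exists u : 'I_(size V) -> R, (forall l, 0 <= u l) /\
    \sum_l u l = 1 /\ p i = \sum_l u l *: V`_l.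
  by move=> i; apply/conv_seqP.
apply/conv_seqP; exists (fun l => \sum_i w i * u i l); split.
  move=> l; apply: sumr_ge0 => i _; apply: mulr_ge0 => //.
  by case: (hu i).
split.
  rewrite exchange_big /= -[RHS]w1; apply: eq_bigr => i _.
  by case: (hu i) => _ [h _]; rewrite -mulr_sumr h mulr1.
transitivity (\sum_i \sum_l (w i * u i l) *: V`_l).
  apply: eq_bigr => i _; case: (hu i) => _ [_ {1}->].
  by rewrite scaler_sumr; apply: eq_bigr => l _; rewrite scalerA.
by rewrite exchange_big; apply: eq_bigr => l _; rewrite scaler_suml.
Qed.

Lemma affine_comb {R : realType} {m n} k (p : 'I_k -> 'rV[R]_m) (w : 'I_k -> R)
    (U : 'M[R]_(m, n)) c :
  \sum_i w i = 1 -> (\sum_i w i *: p i) *m U + c = \sum_i w i *: (p i *m U + c).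
Proof.
move=> w1; under [RHS]eq_bigr do rewrite scalerDr.
rewrite big_split /= -scaler_suml w1 scale1r; congr (_ + c).
by rewrite mulmx_suml; apply: eq_bigr => i _; rewrite -scalemxAl.
Qed.

(** * Completion to a unimodular matrix *)

(** Serves sizes such as [m + t] and [t + m], equal only by a proof. *)
Lemma mulmx1_swap {S : comNzRingType} {p q} (X : 'M[S]_(p, q)) (Y : 'M_(q, p)) :
  p = q -> X *m Y = 1%:M -> Y *m X = 1%:M.
Proof. by move=> E; subst q => /mulmx1C. Qed.

(** By the Smith form, [D] is [L0 *m S] times the first [t] rows of [R0], and the right inverse [A]
    makes [L0 *m S] invertible over the integers; hence the other rows [K0] of [R0] complete [D].
    Subtracting [K0 *m A *m D] arranges [K *m A = 0], so that [A] itself is the last block of the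
    inverse. *)
Lemma unimodular_completion {t m n} (D : 'M[int]_(t, n)) (A : 'M[int]_(n, t)) :
  n = (t + m)%N -> D *m A = 1%:M ->
  exists (K : 'M[int]_(m, n)) (L : 'M[int]_(n, m)),
    col_mx K D *m row_mx L A = 1%:M /\ row_mx L A *m col_mx K D = 1%:M.
Proof.
move=> En; subst n => DA.
have [L0 _ [R0 R0u [d _ DE]]] := int_Smith_normal_form D.
pose S : 'M[int]_t := diag_mx (\row_i d`_i).
have DE' : D = row_mx (L0 *m S) 0 *m R0.
  rewrite DE -(mulmx0 m L0) -mul_mx_row; congr (_ *m _ *m _).
  apply/matrixP => i j; rewrite !mxE; case: splitP => k jk; rewrite !mxE jk.
    by [].
  by rewrite ltn_eqF // (leq_trans (ltn_ord i)) // leq_addr.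
have Su : L0 *m S \in unitmx.
  move: DA; rewrite DE' -mulmxA -[R0 *m A]vsubmxK mul_row_col mul0mx addr0.
  by case/mulmx1_unit.
pose K0 := dsubmx R0.
pose K := K0 - K0 *m A *m D.
have KA : K *m A = 0 by rewrite mulmxBl -!mulmxA DA mulmx1 subrr.
have K0D : col_mx K0 D = block_mx 0 1%:M (L0 *m S) 0 *m R0.
  rewrite -[R0 in RHS]vsubmxK mul_block_col !mul0mx mul1mx add0r addr0.
  by congr col_mx; rewrite {1}DE' -[R0 in LHS]vsubmxK mul_row_col mul0mx addr0.
have Uu : exists Ui, col_mx K D *m Ui = 1%:M :> 'M_(m + t).
  have KD : col_mx K D = block_mx 1%:M (- (K0 *m A)) 0 1%:M *m col_mx K0 D.
    by rewrite mul_block_col !mul1mx mul0mx add0r mulNmx.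
  have [Y YE] : exists Y : 'M_(t + m, m + t), block_mx 0 1%:M (L0 *m S) 0 *m Y = 1%:M.
    exists (block_mx 0 (invmx (L0 *m S)) 1%:M 0).
    rewrite mulmx_block !mul0mx !mulmx0 !addr0 !add0r mulmx1 mulmxV //.
    by rewrite -scalar_mx_block.
  exists (invmx R0 *m Y *m block_mx 1%:M (K0 *m A) 0 1%:M).
  rewrite KD K0D !mulmxA -(mulmxA _ R0) mulmxV // mulmx1.
  rewrite -(mulmxA _ _ Y) YE mulmx1 mulmx_block !mul1mx !mulmx0 !mulmx1 !mul0mx.
  by rewrite !addr0 !add0r subrr -scalar_mx_block.
case: Uu => Ui UUi.
have UiU := mulmx1_swap (addnC m t) UUi.
have AE : A = rsubmx Ui.
  rewrite -[A]mul1mx -UiU -mulmxA mul_col_mx KA DA -[Ui in LHS]hsubmxK.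
  by rewrite mul_row_col mulmx0 mulmx1 add0r.
by exists K, (lsubmx Ui); rewrite AE hsubmxK.
Qed.

Lemma int_mx_floorK {R : realType} {m n} (A : 'M[R]_(m, n)) :
  int_mx A -> map_mx intr (map_mx Num.floor A) = A.
Proof. by move=> Ai; apply/matrixP => i j; rewrite !mxE floorK. Qed.

Lemma int_mx_intr {R : realType} {m n} (A : 'M[int]_(m, n)) :
  int_mx (map_mx intr A : 'M[R]_(m, n)).
Proof. by move=> i j; rewrite mxE intr_int. Qed.

Lemma int_mxM {R : realType} {m n p} (A : 'M[R]_(m, n)) (B : 'M_(n, p)) :
  int_mx A -> int_mx B -> int_mx (A *m B).
Proof. by move=> Ai Bi i j; rewrite mxE; apply: rpred_sum => k _; apply: rpredM. Qed.

Lemma int_vec_mx {R : realType} {n} (v : 'rV[R]_n) : int_vec v -> int_mx v.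
Proof. by move=> vi i j; rewrite ord1. Qed.

Lemma int_completion {R : realType} {t m n} (D : 'M[R]_(t, n)) (A : 'M[R]_(n, t)) :
  n = (t + m)%N -> int_mx D -> int_mx A -> D *m A = 1%:M ->
  exists (K : 'M[R]_(m, n)) (L : 'M[R]_(n, m)), int_mx K /\ int_mx L /\
    col_mx K D *m row_mx L A = 1%:M /\ row_mx L A *m col_mx K D = 1%:M.
Proof.
move=> En Di Ai DA.
have DA' : map_mx Num.floor D *m map_mx Num.floor A = 1%:M.
  apply/matrixP => i j; apply: (@intr_inj R).
  have : map_mx intr (map_mx Num.floor D *m map_mx Num.floor A) i j = (1%:M : 'M[R]_t) i j.
    by rewrite map_mxM !int_mx_floorK // DA.
  by rewrite mxE /= => ->; rewrite !mxE; case: eqP.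
have [K [L [h1 h2]]] := unimodular_completion En DA'.
exists (map_mx intr K), (map_mx intr L); do 2![split; first exact: int_mx_intr].
rewrite -{1}(int_mx_floorK Di) -{1}(int_mx_floorK Ai) -map_col_mx -map_row_mx -map_mxM.
rewrite h1 map_mx1; split=> //.
rewrite -{1}(int_mx_floorK Di) -{1}(int_mx_floorK Ai) -map_col_mx -map_row_mx -map_mxM.
by rewrite h2 map_mx1.
Qed.

Lemma int_dot {R : realType} {n} (a v : 'rV[R]_n) :
  int_vec a -> int_vec v -> dot a v \is a Num.int.
Proof. by move=> ai vi; apply: rpred_sum => i _; apply: rpredM. Qed.

Lemma int_gt0_ge1 {R : realType} (x : R) : x \is a Num.int -> 0 < x -> 1 <= x.
Proof. by case/intrP => z ->; rewrite ltr0z ler1z gtz0_ge1. Qed.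

(** * Cayley sums from integral partitions of unity *)

Lemma cay_eE {R : realType} {t} (i : 'I_t.+1) (j : 'I_t) :
  cay_e R i 0 j = (lift ord0 j == i)%:R.
Proof. by rewrite mxE -val_eqE /=; case: eqP. Qed.

(* The functionals [u_j x = dot (a j) x - b j] for [j > 0] are the last [t]
   coordinates of a unimodular chart in which the vertices with [u_j v = 1] lie over
   the [j]-th vertex of the unimodular simplex. *)
Lemma cayley_of_partition {R : realType} {n t} (V : seq 'rV[R]_n)
    (a : 'I_t.+1 -> 'rV[R]_n) (b : 'I_t.+1 -> R) :
  (forall v, v \in V -> int_vec v) ->
  (forall j, int_vec (a j)) -> (forall j, b j \is a Num.int) ->
  (forall v, v \in V -> forall j, 0 <= dot (a j) v - b j) ->
  (forall v, v \in V -> \sum_j (dot (a j) v - b j) = 1) ->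
  (forall j, exists2 v, v \in V & 0 < dot (a j) v - b j) ->
  exists m (Pi : 'I_t.+1 -> set 'rV[R]_m), (m + t = n)%N /\
    (forall i, lattice_polytope (Pi i)) /\
    unimod_equiv (cayley Pi) (conv [set v | v \in V]).
Proof.
move=> Vi ai bi; pose y j v := dot (a j) v - b j.
rewrite -/(y _ _) => y0 y1 yp.
have yi j v : v \in V -> y j v \is a Num.int.
  by move=> vV; apply: rpredB => //; apply: int_dot => //; apply: Vi.
(* The values at a vertex are nonnegative integers with sum 1, so a positive one is 1 and the others
   vanish. *)
have yE j v k : v \in V -> 0 < y j v -> y k v = (k == j)%:R.
  move=> vV yj.
  have E : y j v + \sum_(i < t.+1 | i != j) y i v = 1 by rewrite -(y1 v vV) [RHS](bigD1 j).
  have y1j := int_gt0_ge1 (yi j v vV) yj.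
  have s0 : 0 <= \sum_(i < t.+1 | i != j) y i v by apply: sumr_ge0 => i _; exact: y0.
  case: eqVneq => [->|kj]; first by rewrite /=; lra.
  have : \sum_(i < t.+1 | i != j) y i v = 0 by lra.
  move/eqP; rewrite psumr_eq0 => [/allP h|i _]; last exact: y0.
  by have := h k (mem_index_enum _); rewrite /= kj => /eqP.
have yex v : v \in V -> exists j, 0 < y j v.
  move=> vV; apply: contrapT => h; have := y1 v vV.
  rewrite big1 => [/eqP|j _]; first by rewrite eq_sym oner_eq0.
  apply/eqP; rewrite eq_le y0 // andbT leNgt; apply/negP => yj.
  by apply: h; exists j.
have /choice[p pP] : forall j, exists v, v \in V /\ 0 < y j v.
  by move=> j; have [v vV vj] := yp j; exists v.
have pV j : p j \in V by case: (pP j).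
have yp' k j : y k (p j) = (k == j)%:R by case: (pP j) => *; apply: yE.
have lift0F (k : 'I_t) : (lift ord0 k == ord0) = false by [].
have dotB j v w : dot (a j) (v - w) = y j v - y j w by rewrite dotBr /y; lra.
(* The columns of [A] are the last [t] coordinate functionals, the rows of [D] the differences
   [p j - p ord0]; by [yp'] they are dual. *)
pose A : 'M[R]_(n, t) := \matrix_(i, j) a (lift ord0 j) 0 i.
pose D : 'M[R]_(t, n) := \matrix_(j, i) (p (lift ord0 j) - p ord0) 0 i.
have mulA (x : 'rV_n) j : (x *m A) 0 j = dot (a (lift ord0 j)) x.
  by rewrite dotC mxE; apply: eq_bigr => i _; rewrite mxE.
have DA : D *m A = 1%:M.
  apply/row_matrixP => j; rewrite row_mul rowK; apply/rowP => k.
  rewrite mulA dotB !yp' (inj_eq lift_inj) lift0F subr0 !mxE.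
  by rewrite eq_sym.
have Ai : int_mx A by move=> i j; rewrite mxE; exact: ai.
have Di : int_mx D by move=> i j; rewrite !mxE; apply: rpredB; apply: Vi.
have tn := mulmx1_min DA.
have [K [L [Ki [Li [UUi UiU]]]]] :=
  int_completion (esym (subnKC tn)) Di Ai DA.
set U := col_mx K D in UUi UiU; set Ui := row_mx L A in UUi UiU.
pose q v := (v - p ord0) *m L.
have chart v j : v \in V -> 0 < y j v -> row_mx (q v) (cay_e R j) *m U + p ord0 = v.
  move=> vV yj.
  suff -> : row_mx (q v) (cay_e R j) = (v - p ord0) *m Ui.
    by rewrite -mulmxA UiU mulmx1 subrK.
  rewrite mul_mx_row; congr row_mx; apply/rowP => k.
  by rewrite mulA dotB yp' (yE j) // cay_eE lift0F subr0.
pose W j := [seq q v | v <- V & 0 < y j v].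
exists (n - t)%N, (fun j => conv [set x | x \in W j]); split; first by rewrite subnK.
split.
  move=> j; exists (W j); split.
    have [v vV vj] := yp j; apply: contraTneq (_ : q v \in W j) => [->//|].
    by apply: map_f; rewrite mem_filter vj.
  split=> // x /mapP[v]; rewrite mem_filter => /andP[_ vV] -> i.
  apply: int_mxM => //; apply: int_vec_mx => k.
  by rewrite !mxE; apply: rpredB; apply: Vi.
exists U, Ui, (p ord0); do !split => //.
- by move=> i j; rewrite mxE; case: split.
- by move=> i j; rewrite mxE; case: split.
- exact: Vi.
apply/seteqP; split=> [x|x [z [k [pz [w [zP [w0 [w1 ->]]]]]] <-]].
  move=> [k [pz [w [pzV [w0 [w1 ->]]]]]].
  have [f fP] := choice (fun i => yex (pz i) (pzV i)).
  exists (\sum_i w i *: row_mx (q (pz i)) (cay_e R (f i))).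
    exists k, (fun i => row_mx (q (pz i)) (cay_e R (f i))), w; do !split => // i.
    exists (f i), (q (pz i)); split=> //; apply: conv_incl; apply: map_f.
    by rewrite mem_filter fP; exact: pzV.
  rewrite affine_comb //; apply: eq_bigr => i _; rewrite chart //.
  exact: pzV.
rewrite affine_comb //; apply: conv_seq_convex => // i.
have [j [_ [[k' [r [w' [rW [w'0 [w'1 ->]]]]]] ->]]] := zP i.
have -> : row_mx (\sum_(i < k') w' i *: r i) (cay_e R j) =
    \sum_(i < k') w' i *: row_mx (r i) (cay_e R j).
  rewrite -[cay_e R j in LHS]scale1r -w'1 scaler_suml.
  under [RHS]eq_bigr do rewrite scale_row_mx.
  elim/big_rec3: _ => [|l u1 u2 u3 _ <-]; first by rewrite row_mx0.
  by rewrite add_row_mx.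
rewrite affine_comb //; apply: conv_seq_convex => // l; apply: conv_incl.
have /mapP[v] := rW l; rewrite mem_filter => /andP[vj vV] ->.
by rewrite /= chart.
Qed.

(** * Facet inequalities *)

(** The terms [w i * (dot a (p i) - b)] are nonnegative with sum zero, so only points on the face
    carry weight. *)
Lemma conv_face {R : realType} {n} (S : set 'rV[R]_n) (a a' : 'rV[R]_n) b b' x :
  (forall v, S v -> b <= dot a v) ->
  (forall v, S v -> dot a v = b -> dot a' v = b') ->
  conv S x -> dot a x = b -> dot a' x = b'.
Proof.
move=> Sb Sa [k [p [w [pS [w0 [w1 ->]]]]]].
have dotw c : dot c (\sum_i w i *: p i) = \sum_i w i * dot c (p i).
  by rewrite dot_sumr; apply: eq_bigr => i _; rewrite dotZr.
rewrite !dotw => /eqP; rewrite -subr_eq0 -[X in _ - X]mul1r -w1 mulr_suml -sumrB.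
rewrite psumr_eq0 => [/allP h|i _]; last first.
  by rewrite -mulrBr mulr_ge0 // subr_ge0; apply: Sb.
rewrite -[RHS]mul1r -w1 mulr_suml; apply: eq_bigr => i _.
have := h i (mem_index_enum _); rewrite /= -mulrBr mulf_eq0 subr_eq0.
by move=> /orP[/eqP ->|/eqP /(Sa _ (pS i)) ->]; rewrite ?mul0r.
Qed.

Lemma conv_dot_const {R : realType} {n} (S : set 'rV[R]_n) (a : 'rV[R]_n) c x :
  (forall v, S v -> dot a v = c) -> conv S x -> dot a x = c.
Proof.
move=> h Sx; apply: (@conv_face _ _ S 0 a 0 c) => //; rewrite ?dot0l // => v Sv.
  by rewrite dot0l.
by move=> _; apply: h.
Qed.

Lemma full_dim_const {R : realType} {n} (S : set 'rV[R]_n) (a : 'rV[R]_n) c :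
  full_dim (conv S) -> (forall v, S v -> dot a v = c) -> a = 0.
Proof.
case=> p [pS rk] Sc; set M := \matrix_(_, _) _ in rk.
have Mu : M \in unitmx by rewrite -row_free_unit; apply/eqP.
apply: trmx_inj; rewrite trmx0 -[a^T](mulKmx Mu) (_ : M *m a^T = 0) ?mulmx0 //.
apply/colP => i; rewrite mxE [RHS]mxE.
transitivity (dot a (p (lift ord0 i) - p ord0)).
  by apply: eq_bigr => j _; rewrite !mxE mulrC.
by rewrite dotBr !(conv_dot_const Sc) // subrr.
Qed.

Lemma primitive_neq0 {R : realType} {n} (a : 'rV[R]_n) : primitive a -> a != 0.
Proof.
case=> _ h; apply/eqP => a0; apply: (h 2%:Z) => //; exists 0.
by rewrite scaler0; split=> // i; rewrite mxE rpred0.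
Qed.

Lemma facet_tight {R : realType} {n} (S : set 'rV[R]_n) a b :
  facet_ineq (conv S) a b -> exists2 v, S v & dot a v = b.
Proof.
move=> [_ [ge [p [pF _]]]]; apply: contrapT => no.
have [pS pb] := pF ord0.
(* If no generator were tight, the hypothesis of [conv_face] on tight generators would hold
   vacuously with any value, such as [b + 1]. *)
have : dot a (p ord0) = b + 1.
  apply: (conv_face _ _ pS pb) => [v Sv|v Sv vb]; first exact/ge/conv_incl.
  by case: no; exists v.
by move: pb => /= ->; lra.
Qed.

(** Differences of points of a facet span dimension [n.-1], so the functionals constant on it form a
    line, spanned by the nonzero [a]. *)
Lemma facet_proportional {R : realType} {n} (S : set 'rV[R]_n) a b a' b' :
  facet_ineq (conv S) a b -> facet_ineq (conv S) a' b' ->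
  (forall v, S v -> dot a v = b -> dot a' v = b') ->
  exists c, a' = c *: a /\ b' = c * b.
Proof.
move=> [pa [ge [p [pF rk]]]] [pa' [ge' _]] h.
have a0 := primitive_neq0 pa.
have face x : conv S x -> dot a x = b -> dot a' x = b'.
  by apply: conv_face => // v Sv; apply/ge/conv_incl.
set M := \matrix_(_, _) _ in rk.
(* The kernel has dimension [n - n.-1], which is 1 only for positive [n]; for [n = 0] there is no
   nonzero [a]. *)
have n_gt0 : (0 < n)%N.
  by case: n a a0 {p pF rk M pa ge face h a' pa' ge' S} => // a; rewrite thinmx0 eqxx.
have ker d : (forall i, dot d (p i) = dot d (p ord0)) -> (d <= kermx M^T)%MS.
  move=> hd; apply/sub_kermxP/rowP => j; rewrite mxE [RHS]mxE.
  transitivity (dot d (p (lift ord0 j) - p ord0)); last by rewrite dotBr hd subrr.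
  by apply: eq_bigr => i _; rewrite !mxE.
have ka : (a <= kermx M^T)%MS.
  by apply: ker => i; case: (pF i) => _ /= ->; case: (pF ord0).
have ka' : (a' <= kermx M^T)%MS.
  by apply: ker => i; case: (pF i) => /face hi /hi ->; case: (pF ord0) => /face h0 /h0.
have : (a' <= a)%MS.
  apply: (submx_trans ka'); rewrite -(mxrank_leqif_sup ka).
  by rewrite mxrank_ker mxrank_tr rk rank_rV a0 -subn1 subKn.
case/sub_rVP => c ac; exists c; split=> //.
have [p0S p0b] := pF ord0.
by rewrite -(face _ p0S p0b) ac dotZl; congr (_ * _).
Qed.

Lemma facet_int {R : realType} {n} (V : seq 'rV[R]_n) a b :
  (forall v, v \in V -> int_vec v) ->
  facet_ineq (conv [set v | v \in V]) a b -> int_vec a /\ b \is a Num.int.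
Proof.
move=> Vi F; have [[ai _] _] := F; split=> //.
by have [v vV <-] := facet_tight F; apply: int_dot => //; apply: Vi.
Qed.

Lemma facet_ge0 {R : realType} {n} (V : seq 'rV[R]_n) a b :
  facet_ineq (conv [set v | v \in V]) a b ->
  forall v, v \in V -> 0 <= dot a v - b.
Proof. by move=> [_ [ge _]] v vV; rewrite subr_ge0; apply/ge/conv_incl. Qed.

(** A functional tight at every vertex is constant on a full-dimensional polytope, hence zero, which
    a primitive one is not. *)
Lemma facet_sum_gt0 {R : realType} {n} (V : seq 'rV[R]_n) a b :
  full_dim (conv [set v | v \in V]) ->
  facet_ineq (conv [set v | v \in V]) a b -> 0 < \sum_(v <- V) (dot a v - b).
Proof.
move=> fd F; have ge := facet_ge0 F.
rewrite lt0r big_seq sumr_ge0 // andbT; apply/negP.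
rewrite psumr_eq0 // => /allP h; have [/primitive_neq0/eqP a0 _] := F; apply: a0.
apply: (full_dim_const (c := b) fd) => v vV.
by have := h v vV; rewrite /= vV /= subr_eq0 => /eqP.
Qed.

(* Up to scaling by a factor [c >= 1] (which makes the inequality weaker on [Ps P s]),
   a facet inequality is determined by the set of vertices at which it is tight. *)
Lemma finitely_many_facets {R : realType} {n} (V : seq 'rV[R]_n) :
  (forall v, v \in V -> int_vec v) -> full_dim (conv [set v | v \in V]) ->
  exists s : seq ('rV[R]_n * R),
    (forall f, f \in s -> facet_ineq (conv [set v | v \in V]) f.1 f.2) /\
    forall a b, facet_ineq (conv [set v | v \in V]) a b ->
      exists f c, f \in s /\ 1 <= c /\ a = c *: f.1 /\ b = c * f.2.
Proof.
move=> Vi fd.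
pose P := conv [set v | v \in V].
pose cls (f : 'rV[R]_n * R) := [set i : 'I_(size V) | dot f.1 V`_i == f.2]%SET.
(* [N] is a natural number on facet inequalities, so each tightness class has a member of least [N];
   as [N] scales with [c], this gives [1 <= c]. *)
pose N (f : 'rV[R]_n * R) := \sum_(v <- V) (dot f.1 v - f.2).
have Nnat g : facet_ineq P g.1 g.2 -> N g \is a Num.nat.
  move=> Fg; have [ai bi] := facet_int Vi Fg.
  rewrite natrEint ltW ?facet_sum_gt0 // andbT /N big_seq.
  by apply: rpred_sum => v vV; apply: rpredB => //; apply: int_dot => //; apply: Vi.
have /choice[F FP] : forall T, exists o : option ('rV[R]_n * R),
    if o is Some f then facet_ineq P f.1 f.2 /\ cls f = T /\
      forall g, facet_ineq P g.1 g.2 -> cls g = T -> N f <= N g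
    else forall g, facet_ineq P g.1 g.2 -> cls g <> T.
  move=> T; pose good k := `[< exists f, facet_ineq P f.1 f.2 /\ cls f = T /\ N f = k%:R >].
  case: (pselect (exists k, good k)) => [ex|no]; last first.
    exists None => g Fg gT; apply: no; have /natrP[k Nk] := Nnat g Fg.
    by exists k; apply/asboolP; exists g.
  case: (ex_minnP ex) => k /asboolP[f [Ff [fT Nf]]] kmin.
  exists (Some f); split=> //; split=> // g Fg gT.
  have /natrP[k' Nk] := Nnat g Fg.
  rewrite Nf Nk ler_nat; apply: kmin; by apply/asboolP; exists g.
exists (pmap F (enum {set 'I_(size V)})); split.
  move=> f; rewrite mem_pmap => /mapP[T _ fT].
  by have := FP T; rewrite -fT => -[].
move=> a b Fab; have := FP (cls (a, b)); case EF: (F _) => [f|]; last first.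
  by move/(_ (a, b)) => /(_ Fab).
move=> [Ff [clsE fmin]].
have [c [ac bc]] : exists c, a = c *: f.1 /\ b = c * f.2.
  apply: (facet_proportional Ff Fab) => v vV /eqP.
  have iV : (index v V < size V)%N by rewrite index_mem.
  have /setP/(_ (Ordinal iV)) := clsE; rewrite !inE /= nth_index // => ->.
  by move/eqP.
exists f, c; split.
  by rewrite mem_pmap; apply/mapP; exists (cls (a, b)); rewrite ?mem_enum ?EF.
split=> //.
have := fmin (a, b) Fab erefl.
have -> : N (a, b) = c * N f.
  by rewrite /N ac bc mulr_sumr; apply: eq_bigr => v _; rewrite /= dotZl mulrBr.
by rewrite -{1}[N f]mul1r ler_pM2r // facet_sum_gt0.
Qed.

(** * Duality for the codegree *)

(** With [sg] the inverse of the codegree, the inequalities [dot (a i) x - b i > sg] have no common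
    solution. Gordan's theorem gives multipliers, which after division by [C] write 1 as
    [\sum_i l i * (dot (a i) x - b i)]. *)
Lemma codegree_dual {R : realType} {n} (V : seq 'rV[R]_n) :
  (forall v, v \in V -> int_vec v) -> V != [::] ->
  full_dim (conv [set v | v \in V]) ->
  codegree (conv [set v | v \in V]) != 0 ->
  exists r (a : 'I_r -> 'rV[R]_n) (b : 'I_r -> R) (l : 'I_r -> R),
    (forall i, facet_ineq (conv [set v | v \in V]) (a i) (b i)) /\
    (forall i, 0 <= l i) /\ \sum_i l i *: a i = 0 /\ \sum_i l i * b i = -1 /\
    codegree (conv [set v | v \in V]) <= \sum_i l i.
Proof.
move=> Vi V0 fd; rewrite /codegree; set P := conv _; set S := [set s : R | _].
rewrite invr_eq0 => s0; pose sg := sup S; rewrite -/sg.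
(* [sup] defaults to 0 on a set without supremum, which a nonzero codegree excludes. *)
have hs : has_sup S by apply: contrapT => /sup_out /eqP; apply/negP.
have sg_gt0 : 0 < sg.
  have [[s Ss] _] := hs; have [s_gt0 _] := Ss.
  exact: lt_le_trans s_gt0 (sup_upper_bound hs Ss).
have [fs [fsF fsP]] := finitely_many_facets Vi fd.
pose a (i : 'I_(size fs)) := (tnth (in_tuple fs) i).1.
pose b (i : 'I_(size fs)) := (tnth (in_tuple fs) i).2.
have abF i : facet_ineq P (a i) (b i) by apply: fsF; apply: mem_tnth.
(* A solution would leave a uniform slack [e] and make [Ps P (sg + e)] nonempty, against the choice
   of [sg]. *)
have infeasible x : ~ (forall i, 0 < dot (a i) x - (b i + sg)).
  move=> h.
  have [e e0 he] : exists2 e, 0 < e & forall i, sg + e <= dot (a i) x - b i.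
    apply: (@uniform_eps _ _ (fun i e => sg + e <= dot (a i) x - b i)) => i.
    exists (dot (a i) x - (b i + sg)) => // d /andP[_]; lra.
  suff : sg + e <= sg by rewrite gerDl leNgt e0.
  apply: sup_upper_bound => //; split; first exact: addr_gt0.
  exists x => a' b' /fsP[f [c [fin [c1 [-> ->]]]]].
  have /tnthP[i fi] : f \in in_tuple fs by [].
  have := he i; rewrite /a /b -fi dotZl -mulrBr => hi.
  apply: (le_trans hi); rewrite ler_peMl // (le_trans _ hi) //.
  by rewrite ltW // addr_gt0.
(* An added coordinate homogenizes the system; the functional at [ord0] makes it positive, so that
   one can divide by it. *)
pose g (i : 'I_(size fs).+1) : 'rV[R]_(n + 1) :=
  if unlift ord0 i is Some j then row_mx (a j) (- (b j + sg))%:M else row_mx 0 1%:M.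
have g0 : g ord0 = row_mx 0 1%:M by rewrite /g unlift_none.
have gS j : g (lift ord0 j) = row_mx (a j) (- (b j + sg))%:M by rewrite /g liftK.
have [|l [l0 [[i0 li0] ls]]] := gordan (f := g).
  case=> z hz; pose x := lsubmx z; pose h := rsubmx z 0 0.
  have zE : z = row_mx x h%:M by rewrite -[LHS]hsubmxK -mx11_scalar.
  have h0 : 0 < h by have := hz ord0; rewrite g0 zE dot_row_mx dot0l dot_scalar add0r mul1r.
  apply: (infeasible (h^-1 *: x)) => i.
  have := hz (lift ord0 i); rewrite gS zE dot_row_mx dot_scalar => hi.
  rewrite dotZr -(pmulr_rgt0 _ h0) mulrBr mulrA mulfV ?gt_eqF // mul1r.
  by rewrite mulrC; move: hi; rewrite mulNr.
pose l' j := l (lift ord0 j).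
have l'0 j : 0 <= l' j by apply: l0.
move: ls; rewrite big_ord_recl g0 scale_row_mx scaler0.
under eq_bigr do rewrite gS scale_row_mx.
have -> : \sum_(i < size fs) row_mx (l (lift ord0 i) *: a i)
      (l (lift ord0 i) *: (- (b i + sg))%:M) =
    row_mx (\sum_i l' i *: a i) (\sum_i l' i * - (b i + sg))%:M.
  rewrite raddf_sum /=; elim/big_rec3: _ => [|i u1 u2 u3 _ ->]; first by rewrite row_mx0.
  by rewrite add_row_mx scale_scalar_mx.
rewrite add_row_mx add0r -[0 in RHS]row_mx0 => /eq_row_mx[la lb].
have {}lb : l ord0 + \sum_i l' i * - (b i + sg) = 0.
  by move: lb; rewrite scale_scalar_mx mulr1 -raddfD /= => /matrixP/(_ 0 0);
    rewrite !mxE eqxx mulr1n.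
(* By [CV], [C] is the constant value of the weighted sum of facet functionals; by [CE] it is at
   most [sg] times the total weight. *)
pose C := - \sum_i l' i * b i.
have CE : C = sg * (\sum_i l' i) - l ord0.
  have : \sum_i l' i * - (b i + sg) = C - sg * (\sum_i l' i).
    rewrite /C mulr_sumr -sumrN -sumrB; apply: eq_bigr => i _; lra.
  by move: lb => /[swap] ->; lra.
have CV v : C = \sum_i l' i * (dot (a i) v - b i).
  have : \sum_i l' i * dot (a i) v = 0.
    rewrite -[RHS](dot0l v) -la dot_suml; apply: eq_bigr => i _.
    by rewrite dotZl.
  by move=> h; under eq_bigr do rewrite mulrBr; rewrite sumrB h sub0r.
(* Some [l' j] is positive, since otherwise [lb] forces [l ord0 = 0]; as facet [j] is not tight at
   every vertex, [C] summed over [V] is positive. *)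
have C0 : 0 < C.
  have [j l'j] : exists j, 0 < l' j.
    case: (unliftP ord0 i0) li0 => [j ->|->] li; first by exists j.
    apply: contrapT => no.
    have l'00 j : l' j = 0.
      by apply/eqP; rewrite eq_le l'0 andbT leNgt; apply/negP => h; apply: no; exists j.
    by move: lb li; rewrite big1 => [|j _]; [lra|rewrite l'00 mul0r].
  have : 0 < \sum_(v <- V) C.
    have := facet_sum_gt0 fd (abF j) => Fj.
    apply: lt_le_trans (_ : l' j * \sum_(v <- V) (dot (a j) v - b j) <= _).
      by rewrite mulr_gt0.
    rewrite mulr_sumr big_seq [leRHS]big_seq; apply: ler_sum => v vV.
    rewrite (CV v) (bigD1 j) //= lerDl; apply: sumr_ge0 => i _.
    by rewrite mulr_ge0 //; apply: facet_ge0 vV.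
  rewrite big_const_seq count_predT iter_addr_0 => CC.
  by rewrite pmulrn_lgt0 // in CC; case: (V) V0.
exists (size fs), a, b, (fun i => l' i / C); split=> //; split.
  by move=> i; rewrite divr_ge0 // ltW.
split.
  rewrite -[RHS](scaler0 _ C^-1) -[in RHS]la scaler_sumr; apply: eq_bigr => i _.
  by rewrite scalerA mulrC.
split.
  rewrite (eq_bigr (fun i => l' i * b i / C)) => [|i _]; last by rewrite mulrAC.
  by rewrite -mulr_suml -[X in X / C]opprK -/C mulNr mulfV // gt_eqF.
rewrite -mulr_suml ler_pdivlMr // ler_pdivrMl // CE.
by have := l0 ord0; lra.
Qed.

Lemma codegree_ge0 {R : realType} {n} (P : set 'rV[R]_n) : 0 <= codegree P.
Proof.
rewrite invr_ge0; set S := [set _ | _].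
case: (pselect (has_sup S)) => [hs|/sup_out ->//].
have [[s Ss] _] := hs; have [s_gt0 _] := Ss.
exact: le_trans (ltW s_gt0) (sup_upper_bound hs Ss).
Qed.

(** Pairs [(a, b)] become vectors of dimension [n + 1], of which Carathéodory's theorem keeps an
    independent family. *)
Lemma codegree_dual_basis {R : realType} {n} (V : seq 'rV[R]_n) :
  (forall v, v \in V -> int_vec v) -> V != [::] ->
  full_dim (conv [set v | v \in V]) ->
  codegree (conv [set v | v \in V]) != 0 ->
  exists r (a : 'I_r -> 'rV[R]_n) (b : 'I_r -> R) (l : 'I_r -> R),
    (r <= n.+1)%N /\
    (forall i, facet_ineq (conv [set v | v \in V]) (a i) (b i)) /\
    (forall i, 0 < l i) /\ \sum_i l i *: a i = 0 /\ \sum_i l i * b i = -1 /\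
    codegree (conv [set v | v \in V]) <= \sum_i l i /\
    forall k : 'I_r -> R, \sum_i k i *: a i = 0 -> \sum_i k i * b i = 0 ->
      forall i, k i = 0.
Proof.
move=> Vi V0 fd mu0.
have [r [a [b [l [F [l0 [la [lb lmu]]]]]]]] := codegree_dual Vi V0 fd mu0.
set P := conv _ in F lmu *.
pose hom (x : 'rV[R]_n) (c : R) : 'rV[R]_(n + 1) := row_mx x c%:M.
have hom_sum q (c : 'I_q -> R) (x : 'I_q -> 'rV[R]_n) (d : 'I_q -> R) :
    \sum_i c i *: hom (x i) (d i) = hom (\sum_i c i *: x i) (\sum_i c i * d i).
  under eq_bigr do rewrite scale_row_mx scale_scalar_mx.
  rewrite /hom raddf_sum /=; elim/big_rec3: _ => [|i u1 u2 u3 _ ->].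
    by rewrite row_mx0.
  by rewrite add_row_mx.
have hom_inj x c x' c' : hom x c = hom x' c' -> x = x' /\ c = c'.
  by move=> /eq_row_mx[-> /matrixP/(_ 0 0)]; rewrite !mxE eqxx !mulr1n.
pose X := [set g | exists x c, facet_ineq P x c /\ g = hom x c].
(* Pairing [hom x c] with this vector gives [\sum_(v <- V) (dot x v - c)], positive for every facet
   inequality. *)
have [||r' [g [l' [gX [l'0 [l'g [l'mu ind]]]]]]] := @caratheodory_sum R (n + 1) X
    (hom (\sum_(v <- V) v) (- (size V)%:R)) (hom 0 (-1)) (codegree P).
- move=> _ [x [c [/(facet_sum_gt0 fd) xc ->]]]; move: xc.
  rewrite sumrB big_const_seq count_predT iter_addr_0 dot_row_mx dot_scalar.
  rewrite mulrN mulr_natr; congr (0 < _ - _).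
  apply: esym; apply: (big_morph (dot x)) => [u v|]; first exact: dotDr.
  by rewrite dotC dot0l.
- exists r, (fun i => hom (a i) (b i)), l; split; first by move=> i; exists (a i), (b i).
  by rewrite hom_sum la lb.
have /choice[x /choice[c xc]] : forall i, exists x c, facet_ineq P x c /\ g i = hom x c.
  by move=> i; apply: gX.
have gE : g = fun i => hom (x i) (c i) by apply/funext => i; case: (xc i).
move: l'g; rewrite gE hom_sum => /hom_inj[l'x l'c].
exists r', x, c, l'; split; first by rewrite -addn1; apply: independent_leq ind.
split; first by move=> i; case: (xc i).
do 4![split=> //]; move=> k kx kc; apply: ind.
by rewrite gE hom_sum kx kc /hom -[RHS]row_mx0 raddf0.
Qed.

(** * The Cayley decomposition and its dimension bounds *)

Lemma unimod_equiv_sym {R : realType} {m n} (P : set 'rV[R]_m) (Q : set 'rV[R]_n) :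
  unimod_equiv P Q -> unimod_equiv Q P.
Proof.
case=> U [Ui [w [Uz [Uiz [wz [UUi [UiU ->]]]]]]].
have wUi : int_mx (w *m Ui) by apply: int_mxM => //; apply: int_vec_mx.
exists Ui, U, (- (w *m Ui)); do !split => //.
  by move=> i; rewrite mxE rpredN.
have K x : (x *m U + w) *m Ui - w *m Ui = x.
  by rewrite mulmxDl -mulmxA UUi mulmx1 addrK.
apply/seteqP; split=> [x Px|_ [_ [x Px <-] <-]]; last by rewrite K.
by exists (x *m U + w); [exists x|].
Qed.

Lemma cayley_points {R : realType} {t} (Pi : 'I_t.+1 -> set 'rV[R]_0) :
  (forall i, Pi i !=set0) -> cayley Pi = @Delta R t.
Proof.
move=> Pi0; congr conv; apply/seteqP.
have e0 : cay_e R ord0 = 0 :> 'rV_t by apply/rowP => k; rewrite cay_eE mxE.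
have eS j : cay_e R (lift ord0 j) = delta_mx 0 j :> 'rV_t.
  by apply/rowP => k; rewrite cay_eE mxE (inj_eq lift_inj) eqxx.
split=> x /=.
  move=> [i [p [_ ->]]]; rewrite row_thin_mx.
  by case: (unliftP ord0 i) => [j|] ->; [right; exists j|left].
move=> [->|[j ->]].
  by have [p Pp] := Pi0 ord0; exists ord0, p; rewrite row_thin_mx e0.
by have [p Pp] := Pi0 (lift ord0 j); exists (lift ord0 j), p; rewrite row_thin_mx eS.
Qed.

Lemma lattice_polytope_nonempty {R : realType} {n} (P : set 'rV[R]_n) :
  lattice_polytope P -> P !=set0.
Proof.
case=> -[|v V] [// _ [_ ->]]; exists v; apply: conv_incl.
by rewrite /= mem_head.
Qed.

Lemma floor_lt_nonnat {R : realType} (x : R) :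
  0 <= x -> x \isn't a Num.nat -> (Num.floor x)%:~R < x.
Proof.
move=> x0 xN; rewrite lt_neqAle floor_le andbT.
by apply: contra xN => /eqP E; rewrite natrEint x0 andbT -E intr_int.
Qed.

Lemma int_ltD1 {R : realType} (x y : R) :
  x \is a Num.int -> y \is a Num.int -> (x < y + 1) = (x <= y).
Proof.
by move=> /intrP[z ->] /intrP[u ->]; rewrite -[1]/(1%:~R) -intrD ltr_int ltzD1 ler_int.
Qed.

(** The first bound arises when the difference between 1 and the selected functionals is nonzero at
    some vertex and supplies a summand of its own, the second when it vanishes at all vertices. *)
Lemma cayley_codegree {R : realType} {n} (V : seq 'rV[R]_n) (P := conv [set v | v \in V]) :
  (forall v, v \in V -> int_vec v) -> V != [::] -> full_dim P -> codegree P != 0 ->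
  exists m t (Pi : 'I_t.+1 -> set 'rV[R]_m), (m + t = n)%N /\
    (forall i, lattice_polytope (Pi i)) /\ unimod_equiv (cayley Pi) P /\
    (2 * codegree P <= t%:R + n%:R + 1 \/ codegree P <= t%:R + 1).
Proof.
move=> Vi V0 fd mu0.
have [r [a [b [l [rn [F [l0 [la [lb [lmu ind]]]]]]]]]] := codegree_dual_basis Vi V0 fd mu0.
rewrite -/P in F lmu.
pose y i v := dot (a i) v - b i.
have y0 v : v \in V -> forall i, 0 <= y i v by move=> vV i; apply: facet_ge0 (F i) v vV.
have yi v i : v \in V -> y i v \is a Num.int.
  move=> vV; have [ai bi] := facet_int Vi (F i).
  by apply: rpredB => //; apply: int_dot => //; apply: Vi.
have yex i : exists2 v, v \in V & 0 < y i v.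
  apply: contrapT => no; have := facet_sum_gt0 fd (F i).
  rewrite big_seq big1 ?ltxx // => v vV; apply/eqP; rewrite eq_le -/(y i v) y0 // andbT.
  by rewrite leNgt; apply/negP => h; apply: no; exists v.
have ysum (k : 'I_r -> R) v :
    \sum_i k i * y i v = dot (\sum_i k i *: a i) v - \sum_i k i * b i.
  rewrite dot_suml -sumrB; apply: eq_bigr => i _.
  by rewrite dotZl mulrBr.
have ly v : \sum_i l i * y i v = 1 by rewrite ysum la lb dot0l sub0r opprK.
(* Evaluate at a vertex where the integer [y i v] is at least 1. *)
have l1 i : l i <= 1.
  have [v vV yv] := yex i; rewrite -(ly v) (bigD1 i) //=.
  have : l i * 1 <= l i * y i v by rewrite ler_pM2l // int_gt0_ge1 // yi.
  have : 0 <= \sum_(j < r | j != i) l j * y j v.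
    by apply: sumr_ge0 => j _; rewrite mulr_ge0 ?y0 // ltW.
  by lra.
pose J := [set i | 1 / 2 < l i]%SET.
pose k i : R := (i \in J)%:R.
have kJ (G : 'I_r -> R) : \sum_i k i * G i = \sum_(i in J) G i.
  by rewrite [RHS]big_mkcond; apply: eq_bigr => i _; rewrite /k; case: ifP => _;
    rewrite ?mul1r ?mul0r.
have kG0 v : v \in V -> 0 <= \sum_i k i * y i v.
  by move=> vV; apply: sumr_ge0 => i _; rewrite mulr_ge0 ?y0 ?ler0n.
have ki v : v \in V -> \sum_i k i * y i v \is a Num.int.
  by move=> vV; apply: rpred_sum => i _; apply: rpredM; rewrite ?yi // /k natr_int.
(* At a vertex the [y i], [i] in [J], are natural numbers whose sum weighted by the
   [l i > 1/2] is at most [1]. *)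
have kle1 v : v \in V -> \sum_i k i * y i v <= 1.
  move=> vV; case: (pselect (exists2 i, i \in J & 0 < y i v)) => [[i iJ yiv]|no]; last first.
    rewrite kJ big1 ?ler01 // => i iJ; apply/eqP; rewrite eq_le y0 // andbT leNgt.
    by apply/negP => h; apply: no; exists i.
  suff : \sum_i k i * y i v < 2.
    by rewrite -[2]/(1 + 1) int_ltD1 ?ki ?rpred1.
  have le j : k j * y j v <= 2 * (l j * y j v).
    rewrite mulrA ler_wpM2r ?y0 //; have := l0 j; rewrite /k.
    by rewrite inE; case: (ltP (1 / 2)) => /= ? ?; rewrite ?mulr1n ?mulr0n; lra.
  have -> : 2 = \sum_j 2 * (l j * y j v) by rewrite -mulr_sumr ly mulr1.
  rewrite (bigD1 i) //= [ltRHS](bigD1 i) //=.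
  apply: ltr_leD; last by apply: ler_sum => j _; exact: le.
  by rewrite mulrA ltr_pM2r // /k iJ mulr1n; move: iJ; rewrite inE => ?; lra.
case: (pselect (forall v, v \in V -> \sum_i k i * y i v = 1)) => [k1|nk1].
  have ka : \sum_i k i *: a i = 0.
    apply: (full_dim_const (c := 1 + \sum_i k i * b i) fd) => v vV.
    by have := k1 v vV; rewrite ysum; lra.
  have kb : \sum_i k i * b i = -1.
    case: (V) V0 k1 => [//|v V'] _ /(_ v (mem_head _ _)).
    by rewrite ysum ka dot0l; lra.
  (* [l] and the indicator [k] both represent the constant 1, so independence identifies them;
     [l i > 0] then leaves only the value 1. *)
  have lk i : l i = k i.
    apply/eqP; rewrite -subr_eq0; apply/eqP.
    apply: (ind (fun i => l i - k i)).
      by under eq_bigr do rewrite scalerBl; rewrite sumrB la ka subrr.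
    by under eq_bigr do rewrite mulrBl; rewrite sumrB lb kb subrr.
  have l_1 i : l i = 1.
    have := l0 i; rewrite lk /k; case: (i \in J) => //=; last by rewrite ltxx.
  have [t rE] : exists t, r = t.+1.
    case: (posnP r) => [r0|/prednK <-]; last by exists r.-1.
    have : 0 = -1 :> R by rewrite -lb big1 // => i; by have := leq_ltn_trans (leq0n i) (ltn_ord i); rewrite [X in (_ < X)%N]r0.
    by move/eqP; rewrite eq_sym oppr_eq0 oner_eq0.
  subst r; have [|||||| m [Pi [mt [PiL PiE]]]] := @cayley_of_partition R n t V a b.
  - by [].
  - by move=> j; case: (facet_int Vi (F j)).
  - by move=> j; case: (facet_int Vi (F j)).
  - exact: y0.
  - by move=> v vV; rewrite -[RHS](ly v); apply: eq_bigr => i _; rewrite l_1 mul1r.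
  - exact: yex.
  exists m, t, Pi; do 3![split=> //]; right.
  apply: (le_trans lmu); under eq_bigr do rewrite l_1.
  by rewrite sumr_const card_ord -natr1.
(* At [v0] the difference is positive, so the summand at index 0 is nonempty. *)
have [v0 v0V yv0] : exists2 v, v \in V & \sum_i k i * y i v < 1.
  apply: contrapT => no; apply: nk1 => v vV; apply/eqP; rewrite eq_le kle1 //=.
  by rewrite leNgt; apply/negP => h; apply: no; exists v.
pose a' (j : 'I_#|J|.+1) := if unlift ord0 j is Some i then a (enum_val i) else - \sum_i k i *: a i.
pose b' (j : 'I_#|J|.+1) := if unlift ord0 j is Some i then b (enum_val i) else - (1 + \sum_i k i * b i).
pose y' (j : 'I_#|J|.+1) v := dot (a' j) v - b' j.
have y'0 v : y' ord0 v = 1 - \sum_i k i * y i v.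
  rewrite /y' /a' /b' unlift_none ysum -scaleN1r dotZl; lra.
have y'S i v : y' (lift ord0 i) v = y (enum_val i) v by rewrite /y' /a' /b' liftK.
have [|||||| m [Pi [mt [PiL PiE]]]] := @cayley_of_partition R n #|J| V a' b'.
- by [].
- move=> j; rewrite /a'; case: (unlift _ _) => [i|].
    by case: (facet_int Vi (F (enum_val i))).
  move=> i; rewrite mxE rpredN summxE; apply: rpred_sum => i' _; rewrite mxE.
  by apply: rpredM; [exact: natr_int|case: (facet_int Vi (F i'))].
- move=> j; rewrite /b'; case: (unlift _ _) => [i|].
    by case: (facet_int Vi (F (enum_val i))).
  rewrite rpredN rpredD ?rpred1 //; apply: rpred_sum => i' _.
  by apply: rpredM; [exact: natr_int|case: (facet_int Vi (F i'))].
- move=> v vV j; rewrite -/(y' j v); case: (unliftP ord0 j) => [i|] ->.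
    by rewrite y'S y0.
  by rewrite y'0 subr_ge0 kle1.
- move=> v vV; rewrite -/(y' _ v) big_ord_recl -/(y' _ v) y'0 kJ big_enum_val.
  under [X in _ + X]eq_bigr do rewrite -/(y' _ v) y'S.
  by rewrite subrK.
- move=> j; case: (unliftP ord0 j) => [i|] ->.
    by have [v vV yv] := yex (enum_val i); exists v => //; rewrite -/(y' _ v) y'S.
  by exists v0 => //; rewrite -/(y' _ v0) y'0 subr_gt0.
exists m, #|J|, Pi; do 3![split=> //]; left.
(* Termwise, [l i <= 1] on [J] and [l i <= 1 / 2] off it; there are at most [n + 1] terms. *)
have : 2 * \sum_i l i <= \sum_i (k i + 1).
  rewrite mulr_sumr; apply: ler_sum => i _; have := l1 i; rewrite /k inE.
  by case: (ltP (1 / 2)) => /= ? ?; rewrite ?mulr1n ?mulr0n; lra.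
rewrite big_split /= sumr_const card_ord.
have -> : \sum_i k i = #|J|%:R.
  have := kJ (fun=> 1); rewrite sumr_const => <-.
  by apply: eq_bigr => i _; rewrite mulr1.
have : r%:R <= n%:R + 1 :> R by rewrite natr1 ler_nat.
by move: lmu; lra.
Qed.

Theorem theorem3p4 (R : realType) (n : nat) (P : set 'rV[R]_n) :
  lattice_polytope P -> full_dim P -> ~ unimod_equiv P (@Delta R n) ->
  n%:R > dP P ->
  exists (m t : nat) (Pi : 'I_t.+1 -> set 'rV[R]_m),
    (forall i, lattice_polytope (Pi i)) /\ m%:R <= dP P /\
    unimod_equiv (cayley Pi) P.
Proof.
move=> [V [V0 [Vi PE]]] fd noD nd.
(* Codegree 0 would give [dP P = 2 * n + 1], which exceeds [n]. *)
have mu0 : codegree P != 0.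
  apply/eqP => mu0; move: nd; rewrite /dP mu0 rpred0 subr0 ltNge => /negP; apply.
  by have := ler0n R n; lra.
have mu_ge0 := codegree_ge0 P.
move: (fd) (mu0); rewrite PE => fd' mu0'.
have [m [t [Pi [mt [PiL]]]]] := cayley_codegree Vi V0 fd' mu0'.
rewrite -PE => -[PiE bound]; exists m, t, Pi; do 2![split=> //].
(* For [m = 0] the Cayley sum is the unimodular simplex, which is excluded. *)
have m_gt0 : (0 < m)%N.
  rewrite lt0n; apply/eqP => m0; apply: noD.
  subst m; rewrite add0n in mt; subst t.
  rewrite -(cayley_points (fun i => lattice_polytope_nonempty (PiL i))).
  exact: unimod_equiv_sym.
have mtR : m%:R + t%:R = n%:R :> R by rewrite -natrD mt.
have m_ge0 := ler0n R m.
rewrite /dP; case: ifPn => [/natrP[q muq]|muN].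
  case: bound => bound; first by lra.
  (* The second bound reads [m <= n + 1 - q], enough when [q <= n]; a larger [q] would force
     [m = 0]. *)
  have [qn|qn] := leqP q n.
    have : q%:R <= n%:R :> R by rewrite ler_nat.
    by lra.
  have qn' : q%:R >= n%:R + 1 :> R by rewrite natr1 ler_nat.
  have : 1 <= m%:R :> R by rewrite ler1n.
  by lra.
have := floor_lt_nonnat mu_ge0 muN; set f := Num.floor _ => fmu.
case: bound => bound.
  (* The floor is strictly below the codegree, and integrality turns [< t + n + 1] into [<= t + n],
     matching the absence of [+ 1] in this case of [dP]. *)
  suff : 2 * f%:~R <= t%:R + n%:R :> R by lra.
  have : 2 * f%:~R < t%:R + n%:R + 1 :> R by lra.
  by rewrite int_ltD1 ?rpredD ?rpredM ?natr_int ?intr_int.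
have : f%:~R < t%:R + 1 :> R by exact: lt_le_trans bound.
by rewrite int_ltD1 ?natr_int ?intr_int //; lra.
Qed.
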